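(* Let $\mathfrak{L} = H \oplus \bigoplus_{\alpha\in\Lambda}\mathfrak{L}_\alpha$ be a split Leibniz superalgebra over a field $\mathbb{K}$. For $[\alpha]\in\Lambda/\sim$ let $I_{[\alpha]} := H_{[\alpha]}\oplus V_{[\alpha]}$, which is an ideal of $\mathfrak{L}$, and let $H_\Lambda := \sum_{\beta\in\Lambda}[\mathfrak{L}_\beta,\mathfrak{L}_{-\beta}]$. For a vector space complement $\mathcal{U}$ of $H_\Lambda$ in $H$, it follows that $$\mathfrak{L} = \mathcal{U} + \sum_{[\alpha]\in\Lambda/\sim} I_{[\alpha]}.$$ Moreover, $[I_{[\alpha]},I_{[\beta]}]=0$ whenever $[\alpha]\neq[\beta]$.
   Context: Let $\mathbb{K}$ be an arbitrary field. A Leibniz superalgebra is a $\mathbb{Z}_2$-graded $\mathbb{K}$-vector space $\mathfrak{L}=\mathfrak{L}_{\bar 0}\oplus\mathfrak{L}_{\bar 1}$ (of arbitrary dimension) with a bilinear product $[\cdot,\cdot]$ such that, for homogeneous $x\in\mathfrak{L}_{\bar i}$, $y\in\mathfrak{L}_{\bar j}$, $z\in\mathfrak{L}_{\bar k}$, one has $[x,y]\in\mathfrak{L}_{\bar i+\bar j}$ and $[x,[y,z]]=[[x,y],z]-(-1)^{\bar j\bar k}[[x,z],y]$. For subspaces $A,B$, $[A,B]$ denotes the linear span of the products $[a,b]$. A (super)subalgebra is a graded subspace $A$ with $[A,A]\subset A$; it is abelian if $[A,A]=0$. An ideal is a graded subspace $I$ with $[I,\mathfrak{L}]+[\mathfrak{L},I]\subset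 I$. Split: let $H=H_{\bar 0}\oplus H_{\bar 1}$ be a maximal element among the abelian graded subalgebras of $\mathfrak{L}$. For a linear functional $\alpha:H_{\bar 0}\to\mathbb{K}$ put $\mathfrak{L}_\alpha:=\{v\in\mathfrak{L}:[v,h]=\alpha(h)v\ \text{for all } h\in H_{\bar 0}\}$, and $\Lambda:=\{\alpha\in(H_{\bar 0})^*\setminus\{0\}:\mathfrak{L}_\alpha\neq0\}$. $\mathfrak{L}$ is split (with respect to $H$) if $\mathfrak{L}=H\oplus\bigoplus_{\alpha\in\Lambda}\mathfrak{L}_\alpha$. No symmetry of $\Lambda$ is assumed. Connections: $-\Lambda:=\{-\alpha:\alpha\in\Lambda\}$, $\pm\Lambda:=\Lambda\cup-\Lambda$. For $\alpha,\beta\in\Lambda$, $\alpha$ is connected to $\beta$ ($\alpha\sim\beta$) if there are $\alpha_1,\dots,\alpha_n\in\pm\Lambda$ ($n\ge1$) with $\alpha_1=\alpha$; $\alpha_1+\alpha_2,\ \alpha_1+\alpha_2+\alpha_3,\dots,\alpha_1+\cdots+\alpha_{n-1}\in\pm\Lambda$; and $\alpha_1+\cdots+\alpha_n\in\{\beta,-\beta\}$. The relation $\sim$ is an equivalence relation on $\Lambda$; $[\alpha]$ denotes the class of $\alpha$. For $\alpha\in\Lambda$: $H_{[\alpha]}:=\mathrm{span}_{\mathbb{K}}\{[\mathfrak{L}_\beta,\mathfrak{L}_{-\beta}]:\beta\in[\alpha]\}\subset H$ and $V_{[\alpha]}:=\bigoplus_{\beta\in[\alpha]}\mathfrak{L}_\beta$.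 *)

(* Defs.v *)
From HB Require Import structures.
From mathcomp Require Import all_boot all_order all_algebra.
From mathcomp Require Import boolp classical_sets functions.

Import GRing.Theory.
Local Open Scope classical_set_scope.
Local Open Scope ring_scope.

Section Subspaces.
Context {K : fieldType} {V : lmodType K}.

Definition subspace (A : set V) : Prop := GRing.submod_closed (mem A).

Definition linear_span (A : set V) : set V := smallest subspace A.

Definition sum_subspace (A B : set V) : set V := [set a + b | a in A & b in B].

Definition big_sum_subspace {I : Type} (P : set I) (F : I -> set V) : set V :=
  linear_span (\bigcup_(i in P) F i).

Definition direct_sum (A B C : set V) : Prop :=
  C = sum_subspace A B /\ A `&` B = [set 0].

(* The sum of the F i, for i in P, is direct. *)
Definition independent {I : Type} (P : set I) (F : I -> set V) : Prop :=
  forall i, P i -> F i `&` big_sum_subspace (P `\ i) F = [set 0].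

Definition complement_in (B A U : set V) : Prop :=
  subspace U /\ direct_sum U A B.

End Subspaces.

HB.mixin Record Lmodule_isLeibnizSuperalgebra (K : fieldType) L
    of GRing.Lmodule K L := {
  homog : 'Z_2 -> set L;
  homog_subspace : forall i, subspace (homog i);
  homog_direct : direct_sum (homog 0) (homog 1) setT;
  lbr : {bilinear L -> L -> L};
  lbr_homog : forall (i j : 'Z_2) (x y : L),
    homog i x -> homog j y -> homog (i + j) (lbr x y);
  lbr_leibniz : forall (i j k : 'Z_2) (x y z : L),
    homog i x -> homog j y -> homog k z ->
    lbr x (lbr y z) = lbr (lbr x y) z - (-1) ^+ (j * k)%N *: lbr (lbr x z) y
}.

#[short(type="leibnizSuperalgebraType")]
HB.structure Definition LeibnizSuperalgebra (K : fieldType) :=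
  { L of GRing.Lmodule K L & Lmodule_isLeibnizSuperalgebra K L }.

Section LeibnizSuperalgebraTheory.
Context {K : fieldType} {L : leibnizSuperalgebraType K}.

Definition bracket (A B : set L) : set L := linear_span [set lbr a b | a in A & b in B].

Definition graded (A : set L) : Prop :=
  subspace A /\ A = sum_subspace (A `&` homog 0) (A `&` homog 1).

Definition subalgebra (A : set L) : Prop := graded A /\ bracket A A `<=` A.

Definition abelian_subalgebra (A : set L) : Prop :=
  subalgebra A /\ bracket A A = [set 0].

Definition ideal (I : set L) : Prop :=
  graded I /\ sum_subspace (bracket I setT) (bracket setT I) `<=` I.

Definition maximal_abelian (H : set L) : Prop :=
  abelian_subalgebra H /\
  forall A, abelian_subalgebra A -> H `<=` A -> A = H.

Definition even_part (H : set L) : set L := H `&` homog 0.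

(* Functionals on the even part of H are functions on its subtype, which carries
   no module structure of its own: linearity is expressed through the inclusion
   val of that subtype in L. *)
Definition linear_functional {H : set L} (alpha : even_part H -> K) : Prop :=
  forall (c : K) (x y z : even_part H),
    val z = c *: val x + val y -> alpha z = c * alpha x + alpha y.

Definition root_space {H : set L} (alpha : even_part H -> K) : set L :=
  [set v | forall h : even_part H, lbr v (val h) = alpha h *: v].

Definition root_set (H : set L) : set (even_part H -> K) :=
  [set alpha | [/\ linear_functional alpha, alpha <> 0
                 & root_space alpha <> [set 0]]].

Definition split_superalgebra (H : set L) : Prop :=
  [/\ maximal_abelian H,
      independent (root_set H) root_space
    & direct_sum H (big_sum_subspace (root_set H) root_space) setT].

Definition pm_roots (H : set L) : set (even_part H -> K) :=
  root_set H `|` [set - alpha | alpha in root_set H].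

(* The elements of the connection are numbered from 0: a 0, ..., a n.-1. *)
Definition root_connected {H : set L} (alpha beta : even_part H -> K) : Prop :=
  exists (n : nat) (a : nat -> even_part H -> K),
    [/\ (0 < n)%N, a 0%N = alpha,
        forall i, (i < n)%N -> pm_roots H (a i),
        forall m, (2 <= m < n)%N -> pm_roots H (\sum_(i < m) a i)
      & \sum_(i < n) a i = beta \/ \sum_(i < n) a i = - beta].

Definition root_class {H : set L} (alpha : even_part H -> K) :
    set (even_part H -> K) :=
  [set beta | root_set H beta /\ root_connected alpha beta].

Definition root_classes (H : set L) : set (set (even_part H -> K)) :=
  [set root_class alpha | alpha in root_set H].

(* For a set C of functionals, the sum of all [L_beta, L_(-beta)], beta in C. *)
Definition root_H {H : set L} (C : set (even_part H -> K)) : set L :=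
  big_sum_subspace C (fun beta => bracket (root_space beta) (root_space (- beta))).

Definition root_V {H : set L} (C : set (even_part H -> K)) : set L :=
  big_sum_subspace C root_space.

Definition root_I {H : set L} (C : set (even_part H -> K)) : set L :=
  sum_subspace (root_H C) (root_V C).

End LeibnizSuperalgebraTheory.

(* Main.v *)
Require Import Defs.
From mathcomp Require Import all_boot all_order all_algebra.
From mathcomp Require Import boolp classical_sets functions.

Import GRing.Theory.

Set Implicit Arguments.
Unset Strict Implicit.

Local Open Scope classical_set_scope.
Local Open Scope ring_scope.

(** Write R for the set of roots.  Bracketing on the right with an even element
is a derivation, so [L_a, L_b] lies in L_(a+b); and L_0 = H, because the
operators [., h] separate L_0 from every L_a with a nonzero.  Hence [L_a, L_b]
lies in H if a + b = 0, in a root space if a + b is a root, and vanishes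
otherwise.

Call two roots linked when their sum or difference is 0 or belongs to R or -R.
Connection is the reachability relation generated by this symmetric relation:
the partial sums of a connection are, up to sign, successive linked roots.
Connection classes are therefore closed under links
([root_class_link_closed]), and any set of roots closed under links contains
the class of each of its elements ([link_closed_connected]); transitivity and
symmetry of connection, and so the disjointness of distinct classes, follow
from these two facts.

Let P be any set of roots closed under links.  If a is in P and b is a root
outside P, then a + b is neither 0 nor a root, for otherwise a would be linked
to b; so L_a and L_b annihilate each other.  The Leibniz identity spreads this
to [L_a, L_(-a)] and L_b: it expresses their products through products of L_a
or L_(-a) with L_b ([lbr_root_H_foreign]).  So I_P annihilates the root spaces
outside P, and its products with H and with the root spaces of P remain in I_P,
which makes it an ideal ([root_I_ideal]); and two disjoint closed sets have
orthogonal ideals ([bracket_root_I_disjoint]).  The decomposition of L follows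
from H = U + H_R, since each root lies in its own class. *)

(** * Subspaces, spans and sums *)

Section Subspace.
Context {K : fieldType} {V : lmodType K}.
Implicit Types (A B S : set V) (x y : V).

Lemma subspaceP A :
  subspace A <-> A 0 /\ forall c x y, A x -> A y -> A (c *: x + y).
Proof.
rewrite /subspace /GRing.submod_closed; split=> -[A0 Aadd].
  split=> [|c x y Ax Ay]; first by move: A0; rewrite inE.
  by have := Aadd c x y; rewrite !inE; apply.
by split=> [|c x y]; rewrite !inE //; apply: Aadd.
Qed.

Lemma subspace0 {A} : subspace A -> A 0.
Proof. by case/subspaceP. Qed.

Lemma subspaceD {A} : subspace A -> forall x y, A x -> A y -> A (x + y).
Proof.
by move=> /subspaceP[_ sA] x y Ax Ay; rewrite -[x]scale1r; apply: sA.
Qed.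

Lemma subspaceZ {A} : subspace A -> forall c x, A x -> A (c *: x).
Proof.
by move=> /subspaceP[A0 sA] c x Ax; rewrite -[_ *: _]addr0; apply: sA.
Qed.

Lemma subspaceB {A} : subspace A -> forall x y, A x -> A y -> A (x - y).
Proof.
move=> sA x y Ax Ay; apply: (subspaceD sA) => //.
by rewrite -scaleN1r; apply: subspaceZ.
Qed.

Lemma subspace_set0 : subspace [set 0 : V].
Proof.
by apply/subspaceP; split=> //= c x y -> ->; rewrite scaler0 addr0.
Qed.

Lemma subspaceI A B : subspace A -> subspace B -> subspace (A `&` B).
Proof.
move=> /subspaceP[A0 sA] /subspaceP[B0 sB]; apply/subspaceP; split=> //.
by move=> c x y [Ax Bx] [Ay By]; split; [apply: sA | apply: sB].
Qed.

Lemma sub_linear_span A : A `<=` linear_span A.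
Proof. exact: sub_gen_smallest. Qed.

Lemma linear_span_min A S : subspace S -> A `<=` S -> linear_span A `<=` S.
Proof. exact: smallest_sub. Qed.

Lemma linear_span_subspace A : subspace (linear_span A).
Proof.
apply/subspaceP; split=> [S [sS _]|c x y Ax Ay S SA]; first exact: subspace0.
have [/subspaceP[_ sS] _] := SA.
by apply: sS; [apply: Ax | apply: Ay].
Qed.

Lemma sum_subspace_subspace A B :
  subspace A -> subspace B -> subspace (sum_subspace A B).
Proof.
move=> /subspaceP[A0 sA] /subspaceP[B0 sB]; apply/subspaceP; split.
  by exists 0 => //; exists 0 => //; rewrite addr0.
move=> c _ _ [a Aa [b Bb <-]] [a' Aa' [b' Bb' <-]].
exists (c *: a + a'); first exact: sA.
by exists (c *: b + b'); [apply: sB | rewrite scalerDr addrACA].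
Qed.

Lemma sum_subspace_min A B S :
  subspace S -> A `<=` S -> B `<=` S -> sum_subspace A B `<=` S.
Proof.
by move=> sS AS BS _ [a Aa [b Bb <-]]; apply: (subspaceD sS); auto.
Qed.

Lemma sub_sum_subspacel A B : subspace B -> A `<=` sum_subspace A B.
Proof.
by move=> /subspace0 B0 a Aa; exists a => //; exists 0; rewrite ?addr0.
Qed.

Lemma sub_sum_subspacer A B : subspace A -> B `<=` sum_subspace A B.
Proof.
by move=> /subspace0 A0 b Bb; exists 0 => //; exists b; rewrite ?add0r.
Qed.

Lemma big_sum_subspace_subspace I (P : set I) (F : I -> set V) :
  subspace (big_sum_subspace P F).
Proof. exact: linear_span_subspace. Qed.

Lemma sub_big_sum_subspace I (P : set I) (F : I -> set V) i :
  P i -> F i `<=` big_sum_subspace P F.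
Proof. by move=> Pi x Fx; apply: sub_linear_span; exists i. Qed.

Lemma big_sum_subspace_min I (P : set I) (F : I -> set V) S :
  subspace S -> (forall i, P i -> F i `<=` S) -> big_sum_subspace P F `<=` S.
Proof.
by move=> sS FS; apply: linear_span_min => // x [i Pi]; apply: FS.
Qed.

End Subspace.

(** * Graded subspaces of a Leibniz superalgebra *)

Section Superalgebra.
Context {K : fieldType} {L : leibnizSuperalgebraType K}.
Implicit Types (A B S : set L) (x y z : L).

Lemma subspace_lbrl S y : subspace S -> subspace [set x | S (lbr x y)].
Proof.
move=> /subspaceP[S0 sS]; apply/subspaceP; split=> /= [|c u v Su Sv].
  by rewrite linear0l.
by rewrite linearPl; apply: sS.
Qed.

Lemma subspace_lbrr S x : subspace S -> subspace [set y | S (lbr x y)].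
Proof.
move=> /subspaceP[S0 sS]; apply/subspaceP; split=> /= [|c u v Su Sv].
  by rewrite linear0r.
by rewrite linearPr; apply: sS.
Qed.

Lemma lbr_in_bracket A B x y : A x -> B y -> bracket A B (lbr x y).
Proof. by move=> Ax By; apply: sub_linear_span; exists x => //; exists y. Qed.

Lemma bracket_min A B S :
  subspace S -> (forall x y, A x -> B y -> S (lbr x y)) -> bracket A B `<=` S.
Proof.
by move=> sS AB; apply: linear_span_min => // _ [x Ax [y By <-]]; apply: AB.
Qed.

Lemma homog_decomp x :
  exists x0 x1, [/\ homog 0 x0, homog 1 x1 & x = x0 + x1].
Proof.
have [hT _] := @homog_direct K L.
have : setT x by [].
by rewrite {1}hT => -[x0 h0 [x1 h1 <-]]; exists x0, x1.
Qed.

Lemma homog_decomp_uniq x0 x1 y0 y1 :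
  homog 0 x0 -> homog 0 y0 -> homog 1 x1 -> homog 1 y1 ->
  x0 + x1 = y0 + y1 -> x0 = y0 /\ x1 = y1.
Proof.
move=> hx0 hy0 hx1 hy1 e.
have [_ hI] := @homog_direct K L.
have e01 : x0 - y0 = y1 - x1.
  by apply/eqP; rewrite subr_eq addrAC eq_sym subr_eq e addrC.
have : (homog 0 `&` homog 1) (x0 - y0).
  split; first exact: (subspaceB (homog_subspace 0)).
  by rewrite e01; apply: (subspaceB (homog_subspace 1)).
rewrite hI /= => d0; move: (d0); rewrite e01.
move=> /eqP; rewrite subr_eq0 => /eqP ->.
by move/eqP: d0; rewrite subr_eq0 => /eqP ->.
Qed.

(** For a subspace S this is the largest graded subspace of S.  Gradedness of a
span then becomes inclusion of the generators in a subspace. *)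
Definition graded_part S : set L :=
  [set x | exists x0 x1, [/\ S x0, S x1, homog 0 x0, homog 1 x1 & x = x0 + x1]].

Lemma graded_part_subspace S : subspace S -> subspace (graded_part S).
Proof.
move=> /subspaceP[S0 sS].
have /subspaceP[e0 eS] := @homog_subspace K L 0.
have /subspaceP[o0 oS] := @homog_subspace K L 1.
apply/subspaceP; split; first by exists 0, 0; rewrite addr0.
move=> c _ _ [x0 [x1 [? ? ? ? ->]]] [y0 [y1 [? ? ? ? ->]]].
exists (c *: x0 + y0), (c *: x1 + y1); rewrite scalerDr addrACA.
by split=> //; [apply: sS | apply: sS | apply: eS | apply: oS].
Qed.

Lemma graded_partS A B : A `<=` B -> graded_part A `<=` graded_part B.
Proof.
by move=> AB _ [x0 [x1 [? ? ? ? ->]]]; exists x0, x1; split=> //; apply: AB.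
Qed.

Lemma homog_graded_part S i x :
  subspace S -> S x -> homog i x -> graded_part S x.
Proof.
move=> /subspace0 S0 Sx.
have [-> | ->] : i = 0 \/ i = 1.
- by case: i => [[|[|//]] ?]; [left | right]; apply: val_inj.
- move=> hx; exists x, 0; rewrite addr0; split=> //.
  exact: subspace0 (homog_subspace 1).
move=> hx; exists 0, x; rewrite add0r; split=> //.
exact: subspace0 (homog_subspace 0).
Qed.

Lemma gradedP A : graded A <-> subspace A /\ A `<=` graded_part A.
Proof.
split=> -[sA gA]; split=> //.
  by move=> x; rewrite {1}gA => -[x0 [? ?] [x1 [? ?] <-]]; exists x0, x1.
apply/seteqP; split=> [x /gA[x0 [x1 [? ? ? ? ->]]]|].
  by exists x0 => //; exists x1.
by apply: sum_subspace_min => // x [].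
Qed.

Lemma graded_ind A S :
  graded A -> subspace S -> (forall i x, A x -> homog i x -> S x) -> A `<=` S.
Proof.
move=> /gradedP[_ gA] sS AS x /gA[x0 [x1 [Ax0 Ax1 h0 h1 ->]]].
by apply: (subspaceD sS); [apply: AS h0 | apply: AS h1].
Qed.

Lemma graded_sum A B : graded A -> graded B -> graded (sum_subspace A B).
Proof.
move=> /gradedP[sA gA] /gradedP[sB gB]; apply/gradedP.
have sAB := sum_subspace_subspace sA sB; split=> //.
apply: sum_subspace_min; first exact: graded_part_subspace.
  by move=> x /gA; apply: graded_partS; apply: sub_sum_subspacel.
by move=> x /gB; apply: graded_partS; apply: sub_sum_subspacer.
Qed.

Lemma graded_big_sum I (P : set I) (F : I -> set L) :
  (forall i, P i -> graded (F i)) -> graded (big_sum_subspace P F).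
Proof.
move=> gF; have sS := big_sum_subspace_subspace P F.
apply/gradedP; split=> //.
apply: big_sum_subspace_min => [|i Pi x Fx]; first exact: graded_part_subspace.
have /gradedP[_ /(_ x Fx)] := gF i Pi.
by apply: graded_partS; apply: sub_big_sum_subspace.
Qed.

Lemma graded_bracket A B : graded A -> graded B -> graded (bracket A B).
Proof.
move=> gA gB; have sS : subspace (bracket A B) by apply: linear_span_subspace.
have sG := graded_part_subspace sS.
apply/gradedP; split=> //; apply: bracket_min => // x y Ax By.
move: x Ax; apply: graded_ind gA (subspace_lbrl y sG) _ => i x Ax hx /=.
move: y By; apply: graded_ind gB (subspace_lbrr x sG) _ => j y By hy /=.
exact: homog_graded_part sS (lbr_in_bracket Ax By) (lbr_homog _ _ _ _ hx hy).
Qed.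

(** The sign in the Leibniz identity does not involve the degree of x, so the
identity extends to every x by linearity. *)
Lemma lbr_leibnizr (j k : 'Z_2) x y z : homog j y -> homog k z ->
  lbr x (lbr y z) = lbr (lbr x y) z - (-1) ^+ (j * k)%N *: lbr (lbr x z) y.
Proof.
move=> hy hz; have [x0 [x1 [h0 h1 ->]]] := homog_decomp x.
rewrite !linearDl (lbr_leibniz _ _ _ _ _ _ h0 hy hz).
rewrite (lbr_leibniz _ _ _ _ _ _ h1 hy hz).
by rewrite scalerDr opprD addrACA.
Qed.

(** For h even the sign in the Leibniz identity is 1 whatever the degree of y,
which makes it linear in y as well. *)
Lemma lbr_even_derivation x y h : homog 0 h ->
  lbr (lbr x y) h = lbr (lbr x h) y + lbr x (lbr y h).
Proof.
move=> hh; have [y0 [y1 [h0 h1 ->]]] := homog_decomp y.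
rewrite !(linearDl, linearDr) (lbr_leibnizr _ h0 hh) (lbr_leibnizr _ h1 hh).
by rewrite !muln0 expr0 !scale1r addrACA ![_ + (_ - _)]addrC !subrK.
Qed.

(** * Root spaces *)

Section RootSpaces.
Context {H : set L}.
Implicit Types (a b : even_part H -> K) (h : even_part H).

Lemma even_part_val h : H (val h) /\ homog 0 (val h).
Proof. by have := valP h; rewrite inE. Qed.

Lemma root_space_subspace a : subspace (root_space a).
Proof.
apply/subspaceP; split=> [h|c x y ax ay h]; first by rewrite linear0l scaler0.
by rewrite linearPl ax ay scalerDr !scalerA mulrC.
Qed.

(** Bracketing with the even element h preserves degrees, so the eigenvalue
equation splits into the equations for the two homogeneous components. *)
Lemma root_space_graded a : graded (root_space a).
Proof.
apply/gradedP; split=> [|x ax]; first exact: root_space_subspace.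
have [x0 [x1 [h0 h1 ex]]] := homog_decomp x.
suff e h : lbr x0 (val h) = a h *: x0 /\ lbr x1 (val h) = a h *: x1.
  by exists x0, x1; split=> // h; have [] := e h.
have [_ hh] := even_part_val h.
have hi i z : homog i z -> homog i (lbr z (val h)).
  by move=> hz; rewrite -[i]addr0; apply: lbr_homog.
have hZ i z : homog i z -> homog i (a h *: z).
  exact: subspaceZ (homog_subspace i) _ _.
apply: homog_decomp_uniq (hi _ _ h0) (hZ _ _ h0) (hi _ _ h1) (hZ _ _ h1) _.
by rewrite -scalerDr -linearDl -ex ax.
Qed.

Lemma root_space_lbr a b x y :
  root_space a x -> root_space b y -> root_space (a + b) (lbr x y).
Proof.
move=> ax ay h; have [_ hh] := even_part_val h.
by rewrite lbr_even_derivation // ax ay linearZl_LR linearZr_LR -scalerDl.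
Qed.

Lemma linear_functionalN a : linear_functional a -> linear_functional (- a).
Proof. by move=> la c x y z /la e; rewrite !fctE e mulrN opprD. Qed.

Lemma linear_functionalD a b :
  linear_functional a -> linear_functional b -> linear_functional (a + b).
Proof.
move=> la lb c x y z e; rewrite !fctE (la _ _ _ _ e) (lb _ _ _ _ e).
by rewrite mulrDr addrACA.
Qed.

(** Brackets of root vectors are sorted with this dichotomy: the weight of a
nonzero bracket is either 0 or a root. *)
Lemma root_or_zero a x :
  linear_functional a -> a <> 0 -> root_space a x -> root_set H a \/ x = 0.
Proof.
move=> la a0 ax; have [->|x0] := eqVneq x 0; [by right | left].
by split=> // ar; move/eqP: x0; apply; move: ax; rewrite ar.
Qed.

(** * Connection of roots *)

(** One step of a connection, with signs forgotten.  The value 0 covers the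
steps b = a and b = - a, which connect a root to itself and to its opposite. *)
Definition linked a b : Prop :=
  (pm_roots H `|` [set 0]) (b + a) \/ (pm_roots H `|` [set 0]) (b - a).

Lemma pm_rootsN a : pm_roots H a -> pm_roots H (- a).
Proof.
by case=> [ra | [b rb <-]]; [right; exists a | left; rewrite opprK].
Qed.

Lemma linked_sym a b : linked a b -> linked b a.
Proof.
case=> [|ab]; [by rewrite addrC; left | right; rewrite -opprB].
by case: ab => [/pm_rootsN|/= ->]; [left | right; rewrite /= oppr0].
Qed.

(** The form in which links occur in a connection, whose partial sums s are
known up to sign only. *)
Lemma linkedP a b s : s = a \/ s = - a ->
  linked a b <-> exists2 d, (pm_roots H `|` [set 0]) d &
                   s + d = b \/ s + d = - b.
Proof.
have pN d : (pm_roots H `|` [set 0]) d -> (pm_roots H `|` [set 0]) (- d).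
  by case=> [/pm_rootsN|/= ->]; [left | right; rewrite /= oppr0].
move=> es; split=> [[] pd|[d pd ed]].
- case: es => ->.
    exists (- (b + a)); first exact: pN.
    by right; rewrite opprD addrCA subrr addr0.
  by exists (b + a) => //; left; rewrite addrC addrK.
- case: es => ->.
    by exists (b - a) => //; left; rewrite addrC subrK.
  by exists (- (b - a)); [exact: pN | right; rewrite opprB addKr].
case: es ed => -> [] ed.
- by right; rewrite -ed addrC addKr.
- by left; rewrite -[b]opprK -ed opprD addrC addrA subrr add0r; apply: pN.
- by left; rewrite -ed addrC addrA subrr add0r.
- by right; rewrite -[b]opprK -ed opprD opprK addrAC subrr add0r; apply: pN.
Qed.

(** The natural generality of the ideals I_P: P is a union of connection
classes. *)
Definition link_closed (P : set (even_part H -> K)) : Prop :=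
  P `<=` root_set H /\
  forall a b, P a -> root_set H b -> linked a b -> P b.

Lemma root_connected_extend n (s : nat -> even_part H -> K) a b d :
  (0 < n)%N -> s 0%N = a -> (forall i, (i < n)%N -> pm_roots H (s i)) ->
  (forall m, (2 <= m <= n)%N -> pm_roots H (\sum_(i < m) s i)) ->
  pm_roots H d -> \sum_(i < n) s i + d = b \/ \sum_(i < n) s i + d = - b ->
  root_connected a b.
Proof.
move=> n0 s0 ps pS pd e.
pose t i := if (i < n)%N then s i else d.
have tS m : (m <= n)%N -> \sum_(i < m) t i = \sum_(i < m) s i.
  by move=> mn; apply: eq_bigr => i _; rewrite /t (leq_trans (ltn_ord i) mn).
exists n.+1, t; split=> //.
- by rewrite /t n0.
- by move=> i _; rewrite /t; case: ifP => // /ps.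
- by move=> m /andP[m2 mn]; rewrite tS //; apply: pS; rewrite m2.
by rewrite big_ord_recr /= tS // /t ltnn.
Qed.

(** A connection from a to b ends in b or - b, which is in R or -R, so it can
serve as an intermediate partial sum: unless c is b or - b, a link from b to c
provides one more term that prolongs the connection to c or - c. *)
Lemma root_class_link_closed a : link_closed (root_class a).
Proof.
split=> [b []//|b c [rb [n [s [n0 s0 ps pS e]]]] rc bc]; split=> //.
have pb : pm_roots H (\sum_(i < n) s i).
  by case: e => ->; [left | right; exists b].
have [d pd ed] := (linkedP c e).1 bc.
case: pd ed => [pd ed | /= ->]; last by rewrite addr0 => ec; exists n, s.
apply: root_connected_extend pd ed => // m /andP[m2].
by rewrite leq_eqVlt => /orP[/eqP -> // | mn]; apply: pS; rewrite m2.
Qed.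

(** Membership in P propagates along the partial sums of a connection, each of
which is a root up to sign and is linked to the preceding one. *)
Lemma link_closed_connected P a b :
  link_closed P -> P a -> root_set H b -> root_connected a b -> P b.
Proof.
move=> [_ Pcl] Pa rb [n [s [n0 s0 ps pS e]]].
suff Q m : (0 < m <= n)%N -> forall r, root_set H r ->
    \sum_(i < m) s i = r \/ \sum_(i < m) s i = - r -> P r.
  by apply: (Q n) => //; rewrite n0 /=.
elim: m => // -[|m] IH /andP[_ mn] r rr.
  rewrite big_ord1 s0 => er; apply: Pcl Pa rr _.
  by case: er => ->; [right | left]; right; rewrite /= ?subrr ?addNr.
have pd := ps _ mn; have {}IH := IH (ltnW mn).
have [p rp ep] : exists2 p, root_set H p &
    \sum_(i < m.+1) s i = p \/ \sum_(i < m.+1) s i = - p.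
  have : pm_roots H (\sum_(i < m.+1) s i).
    by case: m mn {IH pd} => [|m] mn; [rewrite big_ord1; apply: ps|apply: pS].
  case=> [rS | [p rp <-]]; last by exists p; last right.
  by exists (\sum_(i < m.+1) s i); last left.
have Pp := IH p rp ep.
rewrite big_ord_recr /= => er; apply: Pcl Pp rr _.
by apply/(linkedP r ep); exists (s m.+1) => //; left.
Qed.

Lemma root_class_refl a : root_set H a -> root_class a a.
Proof.
move=> ra; split=> //; exists 1%N, (fun=> a).
by rewrite big_ord1; split=> //; [left | case=> [|[|]] | left].
Qed.

Lemma root_class_trans a b : root_class a b -> root_class b `<=` root_class a.
Proof.
move=> ab c [rc bc].
exact: link_closed_connected (root_class_link_closed a) ab rc bc.
Qed.

(** The elements whose class contains a form a set closed under links, because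
links are symmetric and classes are transitive; this set contains a. *)
Lemma root_class_sym a b : root_set H a -> root_class a b -> root_class b a.
Proof.
move=> ra [rb ab].
suff cl : link_closed [set c | root_set H c /\ root_class c a].
  by have [] := link_closed_connected cl (conj ra (root_class_refl ra)) rb ab.
split=> [c []//|c d [rc ca] rd cd]; split=> //.
have [_ dcl] := root_class_link_closed d.
have dc := dcl _ _ (root_class_refl rd) rc (linked_sym cd).
exact: root_class_trans dc _ ca.
Qed.

Lemma root_classes_disjoint C D a :
  root_classes H C -> root_classes H D -> C a -> D a -> C = D.
Proof.
move=> [c rc <-] [d rd <-] ca da.
have ac := root_class_sym rc ca; have ad := root_class_sym rd da.
apply/seteqP; split; apply: root_class_trans.
  exact: root_class_trans da _ ac.
exact: root_class_trans ca _ ad.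
Qed.

(** * The zero root space *)

Section Split.
Context (Hsplit : split_superalgebra H).

Let Hsub : subspace H.
Proof. by case: Hsplit => -[[[[]]]]. Qed.

Lemma split_decomp x :
  exists u v, [/\ H u, root_V (root_set H) v & x = u + v].
Proof.
case: Hsplit => _ _ [hT _]; have : setT x by [].
by rewrite hT => -[u Hu [v Vv <-]]; exists u, v.
Qed.

Lemma lbrHH x y : H x -> H y -> lbr x y = 0.
Proof.
case: Hsplit => -[[_ HH] _] _ _ Hx Hy.
by have := lbr_in_bracket Hx Hy; rewrite HH.
Qed.

Lemma sub_root_space0 : H `<=` root_space (0 : even_part H -> K).
Proof.
move=> x Hx h; have [Hh _] := even_part_val h.
by rewrite lbrHH // scale0r.
Qed.

(** The length is recorded because the argument that separates L_0 from the
root spaces is an induction on the number of summands, whose vectors change. *)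
Inductive root_sum : nat -> L -> Prop :=
| root_sum0 : root_sum 0 0
| root_sumS n a x y : root_set H a -> root_space a x -> root_sum n y ->
    root_sum n.+1 (x + y).

Lemma root_sumD m n x y :
  root_sum m x -> root_sum n y -> root_sum (m + n) (x + y).
Proof.
move=> rx ry; elim: rx => [|k a u v ra au _ IH]; first by rewrite add0r.
by rewrite addSn -addrA; apply: root_sumS au IH.
Qed.

Lemma root_sumP x : root_V (root_set H) x -> exists n, root_sum n x.
Proof.
move: x; apply: big_sum_subspace_min => [|a ra x ax].
  apply/subspaceP; split=> [|c x y [m rx] [n ry]].
    by exists 0; constructor.
  exists (m + n)%N; apply: root_sumD ry.
  elim: rx => [|k a u v ra au _ IH]; first by rewrite scaler0; constructor.
  rewrite scalerDr; apply: root_sumS ra _ IH.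
  exact: subspaceZ (root_space_subspace a) _ _ au.
by exists 1%N; rewrite -[x]addr0; apply: root_sumS ra ax root_sum0.
Qed.

Lemma root_sum_lbrB n (c : K) h y :
  root_sum n y -> root_sum n (lbr y (val h) - c *: y).
Proof.
elim=> [|k a u v ra au _ IH].
  by rewrite linear0l scaler0 subr0; constructor.
rewrite linearDl scalerDr opprD addrACA; apply: root_sumS ra _ IH.
have sa := root_space_subspace a.
by rewrite au -scalerBl; apply: (subspaceZ sa).
Qed.

(** Write x = u + v with u in L_a, take h with a(h) nonzero, and apply to x the
operator [., h] - a(h).  It kills u and keeps v a sum of n root vectors, while
it multiplies x by - a(h).  So - a(h) x is in L_0 and is a shorter sum: it is 0
by induction. *)
Lemma root_sum_root_space0 n x :
  root_sum n x -> root_space (0 : even_part H -> K) x -> x = 0.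
Proof.
elim: n x => [|n IH] x rx x0; first by inversion rx.
inversion rx as [|m a u v ra au rv em ex]; subst m.
have [_ a0 _] := ra.
have [h ah] : exists h, a h != 0.
  apply: contrapT => nh; apply: a0; apply/funext => h.
  by apply/eqP/negPn/negP => ah; apply: nh; exists h.
rewrite ex; suff : - a h *: x = 0.
  by move/eqP; rewrite scaler_eq0 oppr_eq0 (negPf ah) /= => /eqP.
have e : lbr v (val h) - a h *: v = - a h *: x.
  have : lbr x (val h) - a h *: x = - a h *: x.
    by rewrite x0 scale0r sub0r scaleNr.
  by rewrite -{1 2}ex linearDl au scalerDr opprD addrACA subrr add0r.
apply: IH; first by rewrite -e; apply: root_sum_lbrB.
exact: subspaceZ (root_space_subspace 0) _ _ x0.
Qed.

Lemma root_space0 : root_space (0 : even_part H -> K) = H.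
Proof.
apply/seteqP; split=> [x x0|]; last exact: sub_root_space0.
have [u [v [Hu Vv ex]]] := split_decomp x.
have [n rv] := root_sumP Vv.
suff v0 : v = 0 by rewrite ex v0 addr0.
apply: root_sum_root_space0 rv _; have -> : v = x - u by rewrite ex addrC addKr.
exact: subspaceB (root_space_subspace 0) _ _ x0 (sub_root_space0 Hu).
Qed.

(** * The ideal of a set of roots closed under links *)

Lemma root_space_lbrN a x y :
  root_space a x -> root_space (- a) y -> H (lbr x y).
Proof.
by move=> ax ay; rewrite -root_space0 -(subrr a); apply: root_space_lbr.
Qed.

Lemma root_H_sub (P : set (even_part H -> K)) : root_H P `<=` H.
Proof.
apply: (big_sum_subspace_min Hsub) => a _; apply: (bracket_min Hsub) => x y.
exact: root_space_lbrN.
Qed.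

Lemma split_ind S : subspace S -> H `<=` S ->
  (forall a, root_set H a -> root_space a `<=` S) -> forall x, S x.
Proof.
move=> sS HS aS x; have [u [v [Hu Vv ->]]] := split_decomp x.
apply: (subspaceD sS); first exact: HS.
by move: v Vv; apply: big_sum_subspace_min.
Qed.

Lemma root_H_min (P : set (even_part H -> K)) S : subspace S ->
  (forall a x y, P a -> root_space a x -> root_space (- a) y -> S (lbr x y)) ->
  root_H P `<=` S.
Proof.
move=> sS PS; apply: big_sum_subspace_min => // a Pa.
by apply: bracket_min => // x y; apply: PS.
Qed.

Lemma lbr_root_H (P : set (even_part H -> K)) a x y :
  P a -> root_space a x -> root_space (- a) y -> root_H P (lbr x y).
Proof.
move=> Pa ax ay.
by apply: (sub_big_sum_subspace Pa); apply: lbr_in_bracket.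
Qed.

Lemma direct_sum_root_I (P : set (even_part H -> K)) : P `<=` root_set H ->
  direct_sum (root_H P) (root_V P) (root_I P).
Proof.
move=> PR; split=> //; apply/seteqP; split=> [x [hx vx]|x ->]; last first.
  by split; apply: subspace0; apply: big_sum_subspace_subspace.
case: Hsplit => _ _ [_ <-]; split; first exact: root_H_sub hx.
move: x {hx} vx; apply: big_sum_subspace_min => [|a /PR ra].
  exact: big_sum_subspace_subspace.
exact: sub_big_sum_subspace ra.
Qed.

Section LinkClosed.
Context {P : set (even_part H -> K)} (Pcl : link_closed P).

Let PR : P `<=` root_set H. Proof. by case: Pcl. Qed.

Let sI : subspace (root_I P).
Proof. by apply: sum_subspace_subspace; apply: big_sum_subspace_subspace. Qed.

Let sub_H_I : root_H P `<=` root_I P.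
Proof. by apply: sub_sum_subspacel; apply: big_sum_subspace_subspace. Qed.

Let sub_V_I : root_V P `<=` root_I P.
Proof. by apply: sub_sum_subspacer; apply: big_sum_subspace_subspace. Qed.

Lemma link_closedN a : P a -> root_set H (- a) -> P (- a).
Proof.
by case: Pcl => _ cl Pa ra; apply: cl Pa ra _; left; right; rewrite /= addNr.
Qed.

Lemma link_closedD a b : P a -> root_set H b -> root_set H (a + b) ->
  P (a + b) /\ P b.
Proof.
case: Pcl => _ cl Pa rb rab; split.
  by apply: cl Pa rab _; right; left; left; rewrite addrC addKr.
by apply: cl Pa rb _; left; left; left; rewrite addrC.
Qed.

Lemma root_I_min S : subspace S ->
  (forall a x y, P a -> root_space a x -> root_space (- a) y -> S (lbr x y)) ->
  (forall a, P a -> root_space a `<=` S) -> root_I P `<=` S.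
Proof.
move=> sS hS vS; apply: sum_subspace_min => //; first exact: root_H_min.
exact: big_sum_subspace_min.
Qed.

(** A sum a + b equal to 0 or to a root would be a link from a to b. *)
Lemma lbr_foreign a b x y : P a -> root_set H b -> ~ P b ->
  root_space a x -> root_space b y -> lbr x y = 0 /\ lbr y x = 0.
Proof.
move=> Pa rb nPb ax bY; have ra := PR Pa.
have [la _ _] := ra; have [lb _ _] := rb.
have ab0 : a + b <> 0.
  move/eqP; rewrite addr_eq0 => /eqP ab; apply: nPb.
  have eb : b = - a by rewrite ab opprK.
  by rewrite eb; apply: link_closedN => //; rewrite -eb.
have nr : ~ root_set H (a + b).
  by move=> /(link_closedD Pa rb)[].
have z u : root_space (a + b) u -> u = 0.
  by case/(root_or_zero (linear_functionalD la lb) ab0).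
split; apply: z; first exact: root_space_lbr.
by rewrite addrC; apply: root_space_lbr.
Qed.

(** If L_(-a) is not 0, then - a is also in P.  The Leibniz identity writes both
products as combinations of terms having a factor in [L_a, L_b], [L_b, L_a],
[L_(-a), L_b] or [L_b, L_(-a)], and these vanish by [lbr_foreign]. *)
Lemma lbr_root_H_foreign a b x y z : P a -> root_set H b -> ~ P b ->
  root_space a x -> root_space (- a) y -> root_space b z ->
  lbr (lbr x y) z = 0 /\ lbr z (lbr x y) = 0.
Proof.
move=> Pa rb nPb ax ay bz; have [la a0 _] := PR Pa.
have s0 := @subspace_set0 K L.
have Na0 : - a <> 0 by move/eqP; rewrite oppr_eq0 => /eqP.
have [rNa | ->] := root_or_zero (linear_functionalN la) Na0 ay; last first.
  by rewrite linear0r linear0l linear0r.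
have PNa := link_closedN Pa rNa.
split.
  move: y ay; apply: graded_ind (root_space_graded (- a)) _ _.
    exact: subspace_lbrr (subspace_lbrl z s0).
  move=> j y ay hy /=.
  move: z bz; apply: graded_ind (root_space_graded b) (subspace_lbrr _ s0) _.
  move=> k z bz hz /=; have := lbr_leibnizr x hy hz.
  have [-> _] := lbr_foreign PNa rb nPb ay bz.
  have [-> _] := lbr_foreign Pa rb nPb ax bz.
  by rewrite linear0r linear0l scaler0 subr0.
move: x ax; apply: graded_ind (root_space_graded a) _ _.
  exact: subspace_lbrl (subspace_lbrr z s0).
move=> i x ax hx /=.
move: y ay; apply: graded_ind (root_space_graded (- a)) _ _.
  exact: subspace_lbrr (subspace_lbrr z s0).
move=> j y ay hy /=; rewrite (lbr_leibnizr z hx hy).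
have [_ ->] := lbr_foreign Pa rb nPb ax bz.
have [_ ->] := lbr_foreign PNa rb nPb ay bz.
by rewrite !linear0l scaler0 subr0.
Qed.

Lemma lbr_root_I_foreign b x y : root_set H b -> ~ P b ->
  root_I P x -> root_space b y -> lbr x y = 0 /\ lbr y x = 0.
Proof.
move=> rb nPb Ix bY; have s0 := @subspace_set0 K L; move: x Ix.
apply: root_I_min => [|a u v Pa au av|a Pa u au].
- exact: subspaceI (subspace_lbrl y s0) (subspace_lbrr y s0).
- exact: lbr_root_H_foreign Pa rb nPb au av bY.
exact: lbr_foreign Pa rb nPb au bY.
Qed.

Lemma lbr_root_I_H x u : root_I P x -> H u ->
  root_I P (lbr x u) /\ root_I P (lbr u x).
Proof.
move=> Ix Hu; move: x Ix.
apply: root_I_min => [|a y z Pa ay az|a Pa y ay].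
- exact: subspaceI (subspace_lbrl u sI) (subspace_lbrr u sI).
- have Hyz := root_space_lbrN ay az.
  by split; rewrite /= lbrHH //; apply: subspace0.
have u0 := sub_root_space0 Hu.
split; apply: sub_V_I; apply: (sub_big_sum_subspace Pa).
  by rewrite -[a]addr0; apply: root_space_lbr.
by rewrite -[a]add0r; apply: root_space_lbr.
Qed.

(** If b is outside P, then y is foreign to I_P.  If b is in P, products of L_b
with [L_a, L_(-a)] stay in L_b, as the latter is in H = L_0; products of L_b
with L_a are in H_P if a + b = 0, and otherwise in L_(a+b), which is a root
space of P or 0. *)
Lemma lbr_root_I_root_space b x y : root_set H b -> root_I P x ->
  root_space b y -> root_I P (lbr x y) /\ root_I P (lbr y x).
Proof.
move=> rb Ix bY.
have [Pb | nPb] := pselect (P b); last first.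
  have [e1 e2] := lbr_root_I_foreign rb nPb Ix bY.
  by rewrite e1 e2; split; apply: subspace0.
move: x Ix; have [lb b0 _] := rb.
apply: root_I_min => [|a u v Pa au av|a Pa u au].
- exact: subspaceI (subspace_lbrl y sI) (subspace_lbrr y sI).
- have Huv := sub_root_space0 (root_space_lbrN au av).
  split; apply: sub_V_I; apply: (sub_big_sum_subspace Pb).
    by rewrite -[b]add0r; apply: root_space_lbr.
  by rewrite -[b]addr0; apply: root_space_lbr.
have ra := PR Pa; have [la _ _] := ra.
have [ab0 | ab0] := pselect (a + b = 0).
  have eb : b = - a by apply/eqP; rewrite -addr_eq0 addrC ab0.
  have ea : a = - b by rewrite eb opprK.
  split; apply: sub_H_I.
    by apply: (lbr_root_H Pa) => //; rewrite -eb.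
  by apply: (lbr_root_H Pb) => //; rewrite -ea.
have z w : root_space (a + b) w -> root_I P w.
  move=> abw; have [rab|->] := root_or_zero (linear_functionalD la lb) ab0 abw.
    have [Pab _] := link_closedD Pa rb rab.
    by apply: sub_V_I; apply: (sub_big_sum_subspace Pab).
  exact: subspace0.
split; apply: z; first exact: root_space_lbr.
by rewrite addrC; apply: root_space_lbr.
Qed.

Lemma root_I_ideal : ideal (root_I P).
Proof.
split.
  apply: graded_sum; apply: graded_big_sum => a _.
    by apply: graded_bracket; apply: root_space_graded.
  exact: root_space_graded.
have II x y : root_I P x -> root_I P (lbr x y) /\ root_I P (lbr y x).
  move=> Ix; move: y; apply: split_ind => [|u|b rb y].
  - exact: subspaceI (subspace_lbrr x sI) (subspace_lbrl x sI).
  - exact: lbr_root_I_H.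
  exact: lbr_root_I_root_space.
by apply: sum_subspace_min => //; apply: bracket_min => // x y;
  [move=> /II-/(_ y)[] | move=> _ /II-/(_ x)[]].
Qed.

End LinkClosed.

(** The generators of the two H-parts commute because H is abelian; in every
other pair of generators one is a root vector foreign to the other side. *)
Lemma bracket_root_I_disjoint (P Q : set (even_part H -> K)) :
  link_closed P -> link_closed Q -> (forall a, P a -> ~ Q a) ->
  bracket (root_I P) (root_I Q) = [set 0].
Proof.
move=> Pcl Qcl PQ; have s0 := @subspace_set0 K L.
have [[PR _] [QR _]] := (Pcl, Qcl).
apply/seteqP; split=> [|x ->]; last exact: subspace0 (linear_span_subspace _).
apply: bracket_min => // x y Ix Iy; move: x Ix.
apply: root_I_min (subspace_lbrl y s0) _ _ =>
  [a u v Pa au av|a Pa x ax] /=; last first.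
  by have [_] := lbr_root_I_foreign Qcl (PR a Pa) (PQ a Pa) Iy ax.
move: y Iy; apply: root_I_min (subspace_lbrr _ s0) _ _ =>
  [b w z Qb bw bz|b Qb z bz] /=.
  exact: lbrHH (root_space_lbrN au av) (root_space_lbrN bw bz).
have nPb : ~ P b by move=> /PQ.
by have [] := lbr_root_H_foreign Pcl Pa (QR b Qb) nPb au av bz.
Qed.

Lemma root_H_sub_classes :
  root_H (root_set H) `<=` big_sum_subspace (root_classes H) root_I.
Proof.
have sS := big_sum_subspace_subspace (root_classes H) (@root_I K L H).
apply: root_H_min => // a x y ra ax ay.
apply: (sub_big_sum_subspace (i := root_class a)); first by exists a.
apply: sub_sum_subspacel; first exact: big_sum_subspace_subspace.
exact: lbr_root_H (root_class_refl ra) ax ay.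
Qed.

Lemma root_space_sub_classes a : root_set H a ->
  root_space a `<=` big_sum_subspace (root_classes H) root_I.
Proof.
move=> ra x ax.
apply: (sub_big_sum_subspace (i := root_class a)); first by exists a.
apply: sub_sum_subspacer; first exact: big_sum_subspace_subspace.
exact: sub_big_sum_subspace (root_class_refl ra) _ ax.
Qed.

End Split.

End RootSpaces.
End Superalgebra.

Theorem theorem2p2 (K : fieldType) (L : leibnizSuperalgebraType K) (H : set L)
    (Hsplit : split_superalgebra H) (U : set L)
    (HU : complement_in H (root_H (root_set H)) U) :
  [/\ forall C, root_classes H C ->
        direct_sum (root_H C) (root_V C) (root_I C) /\ ideal (root_I C),
      setT = sum_subspace U (big_sum_subspace (root_classes H) root_I)
    & forall C D, root_classes H C -> root_classes H D -> C <> D ->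
        bracket (root_I C) (root_I D) = [set 0]].
Proof.
have cl C : root_classes H C -> link_closed C.
  by move=> [a _ <-]; apply: root_class_link_closed.
have sS := big_sum_subspace_subspace (root_classes H) (@root_I K L H).
split=> [C /cl Ccl|| C D HC HD CD].
- split; last exact: root_I_ideal.
  by apply: direct_sum_root_I => //; case: Ccl.
- have [sU [HUS _]] := HU.
  apply/seteqP; split=> // x _; move: x.
  have sUS := sum_subspace_subspace sU sS.
  apply: (split_ind Hsplit sUS) => [|a ra x ax].
    rewrite {1}HUS; apply: (sum_subspace_min sUS).
      exact: sub_sum_subspacel.
    by move=> x /root_H_sub_classes; apply: sub_sum_subspacer.
  by apply: sub_sum_subspacer (root_space_sub_classes ra ax).
apply: bracket_root_I_disjoint; [by []|exact: cl|exact: cl|].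
by move=> a Ca Da; apply: CD; apply: root_classes_disjoint Ca Da.
Qed.
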